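(* There exists an absolute constant $C > 0$ such that the following holds. Let $R$ be a ring, and let $A \subset R$ be finite and non-empty. Suppose that $|A + A \cdot A| \leq K |A|$ and $|A \cdot A| \geq |A|/K$ for some $K \geq 1$. Then at least one of the following holds: (i) ($A-A$ has many zero divisors) $|(A-A) \setminus R^*| \geq C^{-1} K^{-C} |A|$; or (ii) (Subring structure) there exists a finite subring $S$ of $R$ such that $A \subset S$ and $|S| \leq C K^C |A|$.
   Context: Rings are associative, but need not be commutative and need not contain a multiplicative identity; accordingly a subring is an additive subgroup closed under multiplication (no identity element is required). For subsets $A,B$ of a ring $R$: $A+B := \{a+b : a\in A, b\in B\}$, $A-B := \{a-b : a \in A, b\in B\}$, $A\cdot B := \{ab : a\in A, b\in B\}$. $|A|$ denotes the cardinality of a finite set $A$. $R^*$ denotes the set of non-zero-divisors of $R$, i.e. the elements $r \in R$ such that $ra \neq 0$ and $ar \neq 0$ whenever $a \in R$, $a \neq 0$. *)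

(* Defs.v *)
From HB Require Import structures.
From mathcomp Require Import all_boot all_order all_algebra finmap.
From mathcomp Require Import boolp reals exp.

Set Implicit Arguments.
Unset Strict Implicit.
Unset Printing Implicit Defensive.

Import Order.TTheory GRing.Theory Num.Theory.

Local Open Scope fset_scope.
Local Open Scope ring_scope.

(* Associative rings, not necessarily commutative or unital.  MathComp's own
   ring structures (pzRingType, nzRingType, ...) all contain a unit. *)
HB.mixin Record Zmodule_isRng R of GRing.Zmodule R := {
  rmul : R -> R -> R;
  rmulA : associative rmul;
  rmulDl : left_distributive rmul +%R;
  rmulDr : right_distributive rmul +%R
}.

#[short(type="rngType")]
HB.structure Definition Rng := { R of Zmodule_isRng R & GRing.Zmodule R }.

Notation "x ** y" := (rmul x y) (at level 40, left associativity) : ring_scope.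

Definition addfs (R : rngType) (A B : {fset R}) : {fset R} :=
  [fset a + b | a in A, b in B].

Definition subfs (R : rngType) (A B : {fset R}) : {fset R} :=
  [fset a - b | a in A, b in B].

Definition mulfs (R : rngType) (A B : {fset R}) : {fset R} :=
  [fset a ** b | a in A, b in B].

(* Membership in R^*.  Taken literally, 0 is a non-zero-divisor exactly when R
   is the zero ring. *)
Definition non_zero_divisor (R : rngType) (r : R) : Prop :=
  forall a : R, a != 0 -> r ** a != 0 /\ a ** r != 0.

(* The set difference A \ R^*. *)
Definition zero_divisors_in (R : rngType) (A : {fset R}) : {fset R} :=
  [fset r in A | ~~ `[< non_zero_divisor r >]].

Definition is_subring (R : rngType) (S : {fset R}) : Prop :=
  [/\ 0 \in S,
      {in S &, forall x y : R, x - y \in S}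
    & {in S &, forall x y : R, x ** y \in S}].

(* Main.v *)
(* Write D = A - A.  The hypotheses and the Plunnecke-Ruzsa inequality give
   |3A - 2A| <= K^O(1) |A|, so that D + D is covered by K^O(1) translates of D.
   The x such that x D is covered by few translates of D are closed under
   subtraction and multiplication, up to polynomial losses, and contain A.

   Suppose that D has few zero divisors, and let S be the set of the x with
   x (c - d) = a - b for some a, b, c, d in A and c - d a non-zero-divisor.
   If |A - xA| <= M |A|, Cauchy-Schwarz yields |A|^3 / M solutions of
   a - x c = b - x d, at least half of which have c - d in R^*: hence x is in S,
   and |S| <= 2 M |A| because such a solution determines x.  Conversely every x
   in S maps the translates of (c - d) D covering D to translates of (a - b) D,
   so it satisfies the covering condition with a fixed exponent.  This gain makes
   S closed under subtraction and multiplication without any further loss. *)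
Require Import Defs.
From mathcomp Require Import all_boot all_order all_algebra finmap.
From mathcomp Require Import boolp reals exp.
From mathcomp Require Import zify ring lra.

Set Implicit Arguments.
Unset Strict Implicit.
Unset Printing Implicit Defensive.

Import Order.TTheory GRing.Theory Num.Theory.

Local Open Scope fset_scope.
Local Open Scope ring_scope.

(** * Cardinalities of images and products *)

Lemma card_fimset (T U : choiceType) (f : T -> U) (A : {fset T}) :
  {in A &, injective f} -> #|` [fset f x | x in A]| = #|` A|.
Proof. by move=> f_inj; rewrite card_in_imfset. Qed.

Lemma card_fsetM (T U : choiceType) (A : {fset T}) (B : {fset U}) :
  #|` A `*` B| = (#|` A| * #|` B|)%N.
Proof.
rewrite !card_fset_sum1 big_imfset2 /=; last by move=> [? ?] [? ?] _ _ [-> ->].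
by rewrite big_distrl /=; apply: eq_bigr => a _; rewrite mul1n.
Qed.

(** * Sumsets in abelian groups: Ruzsa's inequalities and Petridis's lemma *)

Section Sumsets.

Variable V : zmodType.
Implicit Types A B P T X Y Z : {fset V}.

Definition sumset A B := [fset a + b | a in A, b in B].
Definition diffset A B := [fset a - b | a in A, b in B].

Lemma sumsetP A B x :
  reflect (exists a b, [/\ a \in A, b \in B & x = a + b]) (x \in sumset A B).
Proof.
apply: (iffP (imfset2P _ _ _ _ _)) => [[a aA [b bB ->]]|[a [b [aA bB ->]]]].
  by exists a, b.
by exists a => //; exists b.
Qed.

Lemma diffsetP A B x :
  reflect (exists a b, [/\ a \in A, b \in B & x = a - b]) (x \in diffset A B).
Proof.
apply: (iffP (imfset2P _ _ _ _ _)) => [[a aA [b bB ->]]|[a [b [aA bB ->]]]].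
  by exists a, b.
by exists a => //; exists b.
Qed.

Lemma mem_sumset A B a b : a \in A -> b \in B -> a + b \in sumset A B.
Proof. by move=> aA bB; apply/sumsetP; exists a, b. Qed.

Lemma mem_diffset A B a b : a \in A -> b \in B -> a - b \in diffset A B.
Proof. by move=> aA bB; apply/diffsetP; exists a, b. Qed.

Lemma sumset0r A : sumset A fset0 = fset0.
Proof. by apply/fsetP => x; apply/sumsetP => -[a [b []]]; rewrite in_fset0. Qed.

Lemma sumsetS A B A' B' :
  A `<=` A' -> B `<=` B' -> sumset A B `<=` sumset A' B'.
Proof.
move=> /fsubsetP sA /fsubsetP sB; apply/fsubsetP => x /sumsetP [a [b [aA bB ->]]].
by rewrite mem_sumset ?sA ?sB.
Qed.

Lemma sumsetA A B X : sumset A (sumset B X) = sumset (sumset A B) X.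
Proof.
apply/fsetP => x; apply/sumsetP/sumsetP.
  case=> a [_ [aA /sumsetP [b [c [bB cX ->]]] ->]].
  by exists (a + b), c; rewrite mem_sumset // addrA.
case=> _ [c [/sumsetP [a [b [aA bB ->]]] cX ->]].
by exists a, (b + c); rewrite mem_sumset // addrA.
Qed.

Lemma sumsetC A B : sumset A B = sumset B A.
Proof.
by apply/fsetP => x; apply/sumsetP/sumsetP => -[a [b [aA bB ->]]];
  exists b, a; rewrite addrC.
Qed.

Lemma sumsetUr X A B : sumset X (A `|` B) = sumset X A `|` sumset X B.
Proof.
apply/fsetP => x; rewrite in_fsetU; apply/sumsetP/orP.
  case=> a [b [aX]]; rewrite in_fsetU => /orP [bA|bB] ->.
    by left; rewrite mem_sumset.
  by right; rewrite mem_sumset.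
by case=> /sumsetP [a [b [aX bA ->]]]; exists a, b; rewrite in_fsetU bA ?orbT.
Qed.

Lemma card_sumset1 A c : #|` sumset A [fset c]| = #|` A|.
Proof.
rewrite -(card_fimset (A := A) (in2W (@addIr _ c))); congr #|` _|.
apply/fsetP => x; apply/sumsetP/imfsetP.
  by case=> a [b [aA /fset1P -> ->]]; exists a.
by case=> a aA ->; exists a, c; rewrite fset11.
Qed.

Lemma leq_card_sumset A B : (#|` sumset A B| <= #|` A| * #|` B|)%N.
Proof.
rewrite -card_fsetM.
have -> : sumset A B = [fset p.1 + p.2 | p in A `*` B].
  apply/fsetP => x; apply/sumsetP/imfsetP => /=.
    by case=> a [b [aA bB ->]]; exists (a, b); rewrite // in_fsetM aA.
  by case=> -[a b]; rewrite in_fsetM => /andP [aA bB] ->; exists a, b.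
exact: leq_imfset_card.
Qed.

Lemma leq_card_sumsetl A B : B != fset0 -> (#|` A| <= #|` sumset A B|)%N.
Proof.
move=> /fset0Pn [b bB]; rewrite -(card_sumset1 A b).
by apply/fsubset_leq_card/sumsetS => //; rewrite fsub1set.
Qed.

(* The map [(x, y - z) |-> (x + y, x + z)] is injective, the representation
   [y - z] of each difference being fixed beforehand. *)
Lemma ruzsa_triangle X Y Z :
  (#|` X| * #|` diffset Y Z| <= #|` sumset X Y| * #|` sumset X Z|)%N.
Proof.
have /choice [r rP] : forall w : V, exists p : V * V, w \in diffset Y Z ->
    [/\ p.1 \in Y, p.2 \in Z & w = p.1 - p.2].
  move=> w; case: (boolP (w \in diffset Y Z)) => [/diffsetP [y [z [yY zZ ->]]]|_].
    by exists (y, z).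
  by exists (0, 0).
pose f (p : V * V) := (p.1 + (r p.2).1, p.1 + (r p.2).2).
have f_inj : {in X `*` diffset Y Z &, injective f}.
  move=> [x w] [x' w']; rewrite !in_fsetM /= => /andP [_ /rP [_ _ wE]].
  move=> /andP [_ /rP [_ _ wE']] [e1 e2].
  have ww' : w = w'.
    rewrite wE wE'; have := congr2 (fun u v : V => u - v) e1 e2.
    by rewrite /= !opprD addrACA subrr add0r addrACA subrr add0r.
  by move: e1; rewrite ww' => /addIr ->.
rewrite -!card_fsetM -(card_fimset f_inj).
apply/fsubset_leq_card/fsubsetP => z /imfsetP [[x w] /=].
rewrite in_fsetM /= => /andP [xX /rP [yY zZ _]] ->.
by rewrite in_fsetM !mem_sumset.
Qed.

(** Elements of [T] are chosen greedily so that the translates [x + B] stay disjoint, whence the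
    bound on [|X|]. If [t + B] meets some [x + B], then [t] lies in [x + B - B]. *)
Lemma ruzsa_covering T B : B != fset0 -> exists X : {fset V},
  (#|` X| * #|` B| <= #|` sumset T B|)%N /\ T `<=` sumset X (diffset B B).
Proof.
move=> B0; suff [X [XT cX sT]] : exists X : {fset V}, [/\ X `<=` T,
    #|` sumset X B| = (#|` X| * #|` B|)%N & T `<=` sumset X (diffset B B)].
  by exists X; split=> //; rewrite -cX; apply/fsubset_leq_card/sumsetS.
elim/fset1U_rect: T => [|t T tT [X [XT cX sT]]].
  by exists fset0; split=> //; rewrite sumsetC sumset0r cardfs0.
have [dj|] := eqVneq (sumset [fset t] B `&` sumset X B) fset0.
  have tX : t \notin X by apply: contra tT => /(fsubsetP XT).
  exists (t |` X); split; first exact: fsetUS.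
    rewrite sumsetC sumsetUr ![sumset B _]sumsetC.
    have := cardfsUI (sumset [fset t] B) (sumset X B).
    rewrite dj cardfs0 addn0 => ->.
    by rewrite cardfsU1 tX cX (sumsetC [fset t]) card_sumset1 mulnDl mul1n.
  apply/fsubsetP => x /fset1UP [->|/(fsubsetP sT)]; last first.
    by apply/fsubsetP/sumsetS => //; exact: fsubsetUr.
  have [b bB] := fset0Pn _ B0.
  by apply/sumsetP; exists t, (b - b); rewrite fset1U1 mem_diffset // subrr addr0.
move=> /fset0Pn [z]; rewrite in_fsetI => /andP [/sumsetP [_ [b [/fset1P -> bB ->]]]].
case/sumsetP => x [b' [xX b'B e]]; exists X; split=> //.
  by apply: fsubset_trans XT (fsubsetUr _ _).
apply/fsubsetP => y /fset1UP [->|/(fsubsetP sT) //].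
by rewrite -[t](addrK b) e -addrA mem_sumset // mem_diffset.
Qed.

(* Petridis: [X] minimises [#|X + A| / #|X|] among the subsets of [P]; the
   inequality is then proved by adding the elements of [B] one at a time. *)
Lemma petridis P A : P != fset0 -> exists X : {fset V},
  [/\ X != fset0, X `<=` P,
      (#|` sumset X A| * #|` P| <= #|` sumset P A| * #|` X|)%N &
      forall B, (#|` sumset (sumset X A) B| * #|` X| <=
                 #|` sumset X A| * #|` sumset X B|)%N].
Proof.
move=> P0.
have [X [X0 XP minX]] : exists X : {fset V}, [/\ X != fset0, X `<=` P &
    forall Y, Y `<=` P ->
      (#|` sumset X A| * #|` Y| <= #|` sumset Y A| * #|` X|)%N].
  pose ratio X : rat := #|` sumset X A|%:R / #|` X|%:R.
  have PP : P \in fpowerset P by rewrite fpowersetE.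
  pose i0 : fpowerset P := [` PP].
  have [] := @Order.TotalTheory.arg_minP _ _ _ i0 (fun i => val i != fset0)
    (fun i => ratio (val i)) P0.
  move=> [X XP] /= X0 minX; exists X; split; rewrite -?fpowersetE // => Y YP.
  have [->|Y0] := eqVneq Y fset0; first by rewrite cardfs0 muln0.
  rewrite -fpowersetE in YP; have /= := minX [` YP] Y0; rewrite /ratio.
  rewrite ler_pdivrMr ?ltr0n ?cardfs_gt0 // mulrAC ler_pdivlMr ?ltr0n ?cardfs_gt0 //.
  by rewrite -!natrM ler_nat.
exists X; split=> //; first exact: minX.
elim/fset1U_rect => [|c B cB IH]; first by rewrite sumset0r cardfs0.
set XA := sumset X A in IH minX *.
(* For [x] in [W], the point [x + c] is already in [X + B]; for [x] in [Y], all of [x + A + c] is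
   already in [X + A + B]. *)
pose W := [fset x in X | x + c \in sumset X B].
pose Y := [fset x in X | sumset (sumset [fset x] A) [fset c] `<=` sumset XA B].
have WY : W `<=` Y.
  apply/fsubsetP => x; rewrite !inE /= => /andP [xX /sumsetP [x' [b [x'X bB e]]]].
  rewrite xX; apply/fsubsetP => _ /sumsetP [_ [_ [/sumsetP [_ [a [/fset1P -> aA ->]]] /fset1P -> ->]]].
  by rewrite addrAC e addrAC !mem_sumset.
have YX : Y `<=` X by apply/fsubsetP => x; rewrite !inE => /andP [].
(* Adjoining [c] to [B] adds to [X + A + B] at most [|X + A| - |Y + A|] points, and to [X + B]
   exactly [|X| - |W|]. *)
have cY : (#|` sumset XA (c |` B)| + #|` sumset Y A| <= #|` sumset XA B| + #|` XA|)%N.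
  rewrite sumsetUr -(card_sumset1 XA c) -(card_sumset1 (sumset Y A) c).
  rewrite [X in (_ <= X)%N]addnC -[X in (_ <= X)%N]cardfsUI leq_add2l; apply/fsubset_leq_card.
  rewrite fsubsetI; apply/andP; split; first by do 2 apply: sumsetS => //.
  apply/fsubsetP => _ /sumsetP [_ [b [/sumsetP [y [a [yY aA ->]]] bc ->]]].
  move: yY; rewrite !inE /= => /andP [_ /fsubsetP]; apply.
  by rewrite !mem_sumset // fset11.
have cW : (#|` sumset X (c |` B)| + #|` W| = #|` sumset X B| + #|` X|)%N.
  rewrite sumsetUr -(card_sumset1 X c) -(card_sumset1 W c).
  rewrite [RHS]addnC -[RHS]cardfsUI; congr (_ + #|` _|)%N.
  apply/fsetP => z; rewrite in_fsetI; apply/sumsetP/andP.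
    case=> x [_ [xW /fset1P -> ->]]; move: xW; rewrite !inE /= => /andP [xX ?].
    by rewrite mem_sumset // fset11.
  case=> /sumsetP [x [_ [xX /fset1P -> ->]]] xc.
  by exists x, c; rewrite fset11 !inE xX xc.
(* Minimality of the ratio at [X], tested on [Y], compares the two increments. *)
have := fsubset_leq_card WY; have := minX _ (fsubset_trans YX XP).
set m := #|` XA|; set q := #|` X|.
move=> h1 h2.
have : (m * #|` W| <= #|` sumset Y A| * q)%N.
  by apply: leq_trans h1; rewrite leq_mul2l h2 orbT.
nia.
Qed.

End Sumsets.

(** * Plunnecke's inequality and coverings by translates *)

Section Covers.

Variables (V : zmodType) (F : realFieldType).
Implicit Types (A B D E P T X : {fset V}) (m k K : F).

(** For the [X] given by [petridis], each further summand [A] costs a factor [K], so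
    [|X + 2A| <= K^2 |X|] and [|X + 3A| <= K^3 |X|]. Ruzsa's triangle inequality multiplies the two
    bounds. *)
Lemma plunnecke A P K : P != fset0 -> 0 <= K ->
  #|` sumset P A|%:R <= K * #|` P|%:R ->
  #|` diffset (sumset A (sumset A A)) (sumset A A)|%:R <= K ^+ 5 * #|` P|%:R.
Proof.
move=> P0 K0 PA; have [X [X0 XP XA XAB]] := petridis A P0.
have n0 (Y : {fset V}) : Y != fset0 -> 0 < #|` Y|%:R :> F.
  by rewrite ltr0n cardfs_gt0.
have {}XA : #|` sumset X A|%:R <= K * #|` X|%:R :> F.
  rewrite -(ler_pM2r (n0 _ P0)) -natrM mulrAC.
  apply: le_trans (_ : (#|` sumset P A| * #|` X|)%:R <= _); first by rewrite ler_nat.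
  by rewrite natrM ler_wpM2r.
have step B c : #|` sumset X B|%:R <= c * #|` X|%:R :> F ->
    #|` sumset X (sumset A B)|%:R <= K * c * #|` X|%:R :> F.
  move=> XB; rewrite -(ler_pM2r (n0 _ X0)) -natrM sumsetA.
  apply: le_trans (_ : (#|` sumset X A| * #|` sumset X B|)%:R <= _); first by rewrite ler_nat.
  by rewrite natrM (le_trans (ler_pM _ _ XA XB)) //; lra.
have X2A := step _ _ XA; have X3A := step _ _ X2A.
have tri := ruzsa_triangle X (sumset A (sumset A A)) (sumset A A).
have {tri} : #|` X|%:R * #|` diffset (sumset A (sumset A A)) (sumset A A)|%:R
    <= K * (K * K) * #|` X|%:R * (K * K * #|` X|%:R) :> F.
  by rewrite -natrM (le_trans _ (ler_pM _ _ X3A X2A)) // -natrM ler_nat.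
have -> : K * (K * K) * #|` X|%:R * (K * K * #|` X|%:R) =
   #|` X|%:R * (K ^+ 5 * #|` X|%:R) by ring.
rewrite ler_pM2l ?n0 // => /le_trans; apply.
by rewrite ler_wpM2l ?exprn_ge0 // ler_nat fsubset_leq_card.
Qed.

(** The bound [m] lives in [F] so that it can be a power of [K]. *)
Definition covers D m T :=
  exists2 X : {fset V}, #|` X|%:R <= m & T `<=` sumset X D.

Lemma coversW D m m' T : m <= m' -> covers D m T -> covers D m' T.
Proof. by move=> le_m [X cX sT]; exists X => //; apply: le_trans le_m. Qed.

Lemma covers_fsubset D m T T' : T `<=` T' -> covers D m T' -> covers D m T.
Proof. by move=> sT [X cX sT']; exists X => //; apply: fsubset_trans sT'. Qed.

Lemma covers_ge0 D m T : covers D m T -> 0 <= m.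
Proof. by case=> X cX _; apply: le_trans cX. Qed.

Lemma covers_card D m T : covers D m T -> #|` T|%:R <= m * #|` D|%:R.
Proof.
case=> X cX /fsubset_leq_card; rewrite -(ler_nat F) => /le_trans; apply.
apply: le_trans (_ : (#|` X| * #|` D|)%:R <= _).
  by rewrite ler_nat leq_card_sumset.
by rewrite natrM ler_wpM2r.
Qed.

Lemma covers_trans D E m m' T :
  covers E m T -> covers D m' E -> covers D (m * m') T.
Proof.
case=> X cX sT [Y cY sE]; exists (sumset X Y).
  apply: le_trans (_ : (#|` X| * #|` Y|)%:R <= _).
    by rewrite ler_nat leq_card_sumset.
  by rewrite natrM ler_pM.
by rewrite (fsubset_trans sT) // -sumsetA sumsetS.
Qed.

(** The factor [k] is the price of returning from translates of [D + D] to translates of [D]. *)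
Lemma covers_sumset D k m m' T T' : covers D k (sumset D D) ->
  covers D m T -> covers D m' T' -> covers D (m * m' * k) (sumset T T').
Proof.
move=> D2 [X cX /fsubsetP sT] [Y cY /fsubsetP sT'].
apply: covers_trans D2; exists (sumset X Y).
  apply: le_trans (_ : (#|` X| * #|` Y|)%:R <= _).
    by rewrite ler_nat leq_card_sumset.
  by rewrite natrM ler_pM.
apply/fsubsetP => z /sumsetP [t [t' [/sT tE /sT' t'E ->]]].
have /sumsetP [x [d [xX dD ->]]] := tE; have /sumsetP [y [e [yY eD ->]]] := t'E.
by rewrite addrACA !mem_sumset.
Qed.

Lemma covers_oppset D m T : {in D, forall d, - d \in D} ->
  covers D m T -> covers D m [fset - t | t in T].
Proof.
move=> oppD [X cX /fsubsetP sT]; exists [fset - x | x in X].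
  by rewrite card_fimset // => x y _ _ /oppr_inj.
apply/fsubsetP => _ /imfsetP [_ /= /sT /sumsetP [x [d [xX dD ->]]] ->].
by rewrite opprD mem_sumset ?oppD // in_imfset.
Qed.

Lemma covers_diffset D k m m' T T' : {in D, forall d, - d \in D} ->
  covers D k (sumset D D) -> covers D m T -> covers D m' T' ->
  covers D (m * m' * k) (diffset T T').
Proof.
move=> oppD D2 mT /(covers_oppset oppD) mT'.
apply: covers_fsubset (covers_sumset D2 mT mT').
apply/fsubsetP => _ /diffsetP [t [t' [tT tT' ->]]].
by rewrite mem_sumset // in_imfset.
Qed.

Lemma covers_of_card T B m : B != fset0 ->
  #|` sumset T B|%:R <= m * #|` B|%:R -> covers (diffset B B) m T.
Proof.
move=> B0 TB; have [X [cX sT]] := ruzsa_covering T B0; exists X => //.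
have cB : 0 < #|` B|%:R :> F by rewrite ltr0n cardfs_gt0.
by rewrite -(ler_pM2r cB) (le_trans _ TB) // -natrM ler_nat.
Qed.

End Covers.

(** * Counting collisions and fibres *)

Lemma card_fset_filter (T : choiceType) (P : {fset T}) (p : pred T) :
  #|` [fset x in P | p x]| = (\sum_(x <- P) p x)%N.
Proof.
by rewrite card_fset_sum1 big_fset /= big_mkcond; apply: eq_bigr => x; case: (p x).
Qed.

Section Counting.

Variables T U : choiceType.
Implicit Types (P : {fset T}) (Q : {fset U}).

(* Cauchy-Schwarz, applied to the sizes of the fibres of [f]. *)
Lemma card_collisions P (f : T -> U) :
  (#|` P| ^ 2 <= #|` [fset f p | p in P]| *
     #|` [fset q in P `*` P | f q.1 == f q.2]|)%N.
Proof.
pose I := [fset f p | p in P]; pose r s := (\sum_(p <- P) (f p == s))%N.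
have sumI p : p \in P -> (\sum_(s <- I) (f p == s) = 1)%N.
  move=> pP; have fI : f p \in I by rewrite in_imfset.
  rewrite (big_fsetD1 _ fI) /= eqxx big_seq big1 // => s.
  by rewrite in_fsetD1 eq_sym => /andP [/negbTE ->].
have cP : #|` P| = (\sum_(s <- I) r s)%N.
  rewrite exchange_big /= card_fset_sum1 big_seq [RHS]big_seq.
  by apply: eq_bigr => p /sumI.
have cE : #|` [fset q in P `*` P | f q.1 == f q.2]| = (\sum_(s <- I) r s ^ 2)%N.
  rewrite card_fset_filter big_imfset2 /=; last by move=> [? ?] [? ?] _ _ [-> ->].
  transitivity (\sum_(s <- I) \sum_(p <- P) \sum_(q <- P) (f p == s) * (f q == s))%N.
    rewrite [RHS]exchange_big /= big_seq [RHS]big_seq; apply: eq_bigr => p pP.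
    rewrite [RHS]exchange_big /=; apply: eq_bigr => q _.
    have fI : f p \in I by rewrite in_imfset.
    rewrite (big_fsetD1 _ fI) /= eqxx mul1n [f q == _]eq_sym big_seq big1 ?addn0 // => s.
    by rewrite in_fsetD1 eq_sym => /andP [/negbTE ->].
  apply: eq_bigr => s _; rewrite -mulnn big_distrl /=.
  by apply: eq_bigr => p _; rewrite big_distrr.
have constI c : (\sum_(s <- I) c = #|` I| * c)%N.
  by rewrite card_fset_sum1 big_distrl /=; apply: eq_bigr => s _; rewrite mul1n.
(* Once doubled, the inequality is [2 r(s) r(t) <= r(s)^2 + r(t)^2] summed over all pairs of
   fibres. *)
rewrite cE -(@leq_pmul2l 2) // {1}cP -mulnn big_distrlr big_distrr /=.
apply: (@leq_trans (\sum_(s <- I) \sum_(t <- I) (r s ^ 2 + r t ^ 2))%N).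
  apply: leq_sum => s _; rewrite big_distrr /=.
  by apply: leq_sum => t _; exact: nat_Cauchy.
rewrite (eq_bigr (fun s => #|` I| * r s ^ 2 + \sum_(t <- I) r t ^ 2)%N); last first.
  by move=> s _; rewrite big_split /= constI.
by rewrite big_split /= -big_distrr /= constI addnn -mul2n.
Qed.

(** The hypothesis makes the counted subsets of [P] pairwise disjoint. *)
Lemma sum_card_disjoint P Q (g : U -> pred T) :
  (forall x y q, g x q -> g y q -> x = y) ->
  (\sum_(x <- Q) #|` [fset q in P | g x q]| <= #|` P|)%N.
Proof.
move=> g_inj; under eq_bigr do rewrite card_fset_filter.
rewrite exchange_big card_fset_sum1 /=; apply: leq_sum => q _.
rewrite big_seq; case: (pselect (exists2 x, x \in Q & g x q)) => [[x xQ gx]|no].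
  rewrite -big_seq (big_fsetD1 _ xQ) /= gx big_seq big1 // => y.
  rewrite in_fsetD1 => /andP [/eqP yx _]; apply/eqP; rewrite eqb0.
  by apply/negP => /g_inj /(_ gx).
rewrite big1 // => x xQ; apply/eqP; rewrite eqb0; apply/negP => gx.
by apply: no; exists x.
Qed.

(** This will collect fractions into a finite set although the ring may be infinite: each [p]
    contributes at most one element. *)
Lemma fset_of_functional_rel P (rel : T -> U -> Prop) :
  (forall p x y, rel p x -> rel p y -> x = y) ->
  exists Q, forall x, x \in Q <-> exists2 p, p \in P & rel p x.
Proof.
move=> fun_rel; elim/fset1U_rect: P => [|p P _ [Q IH]].
  by exists fset0 => x; split=> // -[].
case: (pselect (exists x, rel p x)) => [[x px]|no].
  exists (x |` Q) => y; split=> [/fset1UP [->|/IH [q qP qy]]|[q /fset1UP [->|qP] qy]].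
  - by exists p; rewrite ?fset1U1.
  - by exists q => //; rewrite fset1Ur.
  - by rewrite (fun_rel _ _ _ qy px) fset1U1.
  - by rewrite fset1Ur //; apply/IH; exists q.
exists Q => y; split=> [/IH [q qP qy]|[q /fset1UP [->|qP] qy]].
- by exists q => //; rewrite fset1Ur.
- by case: no; exists y.
- by apply/IH; exists q.
Qed.

End Counting.

(** * Dilates and representations as fractions *)

Section Multiplication.

Variables (R : rngType) (F : realFieldType).
Implicit Types (x y u v : R) (A D E T : {fset R}) (k m : F).

Lemma rmulBr x a b : x ** (a - b) = x ** a - x ** b.
Proof. by apply: (addIr (x ** b)); rewrite -rmulDr !subrK. Qed.

Lemma rmulBl x a b : (a - b) ** x = a ** x - b ** x.
Proof. by apply: (addIr (b ** x)); rewrite -rmulDl !subrK. Qed.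

Lemma non_zero_divisor_injl u : non_zero_divisor u -> injective (rmul u).
Proof.
move=> nzu x y /eqP; rewrite -subr_eq0 -rmulBr => /eqP e.
by apply/eqP; rewrite -subr_eq0; apply/negP => /negP /nzu [/eqP + _]; apply.
Qed.

Lemma non_zero_divisor_injr u : non_zero_divisor u -> injective (rmul^~ u).
Proof.
move=> nzu x y /eqP; rewrite -subr_eq0 -rmulBl => /eqP e.
by apply/eqP; rewrite -subr_eq0; apply/negP => /negP /nzu [_ /eqP]; apply.
Qed.

Definition lmul x T := [fset x ** t | t in T].

Lemma card_lmul x T : non_zero_divisor x -> #|` lmul x T| = #|` T|.
Proof. by move=> nzx; apply: card_fimset => a b _ _; apply: non_zero_divisor_injl. Qed.

Lemma leq_card_lmul x T : (#|` lmul x T| <= #|` T|)%N.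
Proof. exact: leq_imfset_card. Qed.

Lemma lmul_diffset x A B : diffset (lmul x A) (lmul x B) = lmul x (diffset A B).
Proof.
apply/fsetP => z; apply/diffsetP/imfsetP => /=.
  case=> _ [_ [/imfsetP [a /= aA ->] /imfsetP [b /= bB ->] ->]].
  by exists (a - b); rewrite ?mem_diffset // rmulBr.
case=> _ /diffsetP [a [b [aA bB ->]]] ->.
by exists (x ** a), (x ** b); rewrite !in_imfset // rmulBr.
Qed.

Lemma lmulA x y T : lmul x (lmul y T) = lmul (x ** y) T.
Proof.
apply/fsetP => z; apply/imfsetP/imfsetP => /=.
  by case=> _ /imfsetP [t /= tT ->] ->; exists t => //; rewrite rmulA.
by case=> t tT ->; exists (y ** t); rewrite ?in_imfset // rmulA.
Qed.

Lemma covers_lmul D E x m m' T :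
  covers E m T -> covers D m' (lmul x E) -> covers D (m * m') (lmul x T).
Proof.
case=> X cX /fsubsetP sT; apply: covers_trans; exists (lmul x X).
  by apply: le_trans cX; rewrite ler_nat leq_card_lmul.
apply/fsubsetP => _ /imfsetP [t /= /sT /sumsetP [y [e [yX eE ->]]] ->].
by rewrite rmulDr mem_sumset // in_imfset.
Qed.

(** A quadruple [((a, c), (b, d))] witnesses [x (c - d) = a - b]; its halves are two pairs on which
    [a - x c] takes the same value. *)
Definition fractions A (Z : {fset R}) x : {fset (R * R) * (R * R)} :=
  [fset q in (A `*` A) `*` (A `*` A) |
     (q.1.1 - q.2.1 == x ** (q.1.2 - q.2.2)) && (q.1.2 - q.2.2 \notin Z)].

(** Apply [card_collisions] to [(a, c) |-> a - x c], whose image is [A - x A]. The collisions that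
    are not counted as fractions have [c - d] in [Z], and there are at most [|Z| |A|^2] of them. *)
Lemma card_fractions A (Z : {fset R}) x :
  (#|` A| ^ 4 <= #|` diffset A (lmul x A)| *
     (#|` fractions A Z x| + #|` Z| * #|` A| ^ 2))%N.
Proof.
pose f (p : R * R) := p.1 - x ** p.2.
pose E := [fset q in (A `*` A) `*` (A `*` A) | f q.1 == f q.2].
have -> : diffset A (lmul x A) = [fset f p | p in A `*` A].
  apply/fsetP => z; apply/diffsetP/imfsetP => /=.
    case=> a [_ [aA /imfsetP [b /= bA ->] ->]].
    by exists (a, b); rewrite // in_fsetM aA.
  case=> -[a b]; rewrite in_fsetM => /andP [/= aA bA] ->.
  by exists a, (x ** b); rewrite in_imfset.
have -> : (#|` A| ^ 4 = #|` A `*` A| ^ 2)%N by rewrite card_fsetM; ring.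
apply: leq_trans (card_collisions _ f) _; rewrite leq_mul2l; apply/orP; right.
rewrite -/E -(cardfsID (fractions A Z x) E) leq_add //.
  exact/fsubset_leq_card/fsubsetIr.
rewrite -mulnn -!card_fsetM.
pose h (q : (R * R) * (R * R)) := (q.1.2 - q.2.2, (q.1.2, q.1.1)).
have fE (q : (R * R) * (R * R)) :
    (f q.1 == f q.2) = (q.1.1 - q.2.1 == x ** (q.1.2 - q.2.2)).
  rewrite rmulBr /f -subr_eq0 -[RHS]subr_eq0; congr (_ == 0).
  by rewrite !opprB addrACA [RHS]addrACA [- (x ** _) - _]addrC.
have hI : {in E `\` fractions A Z x &, injective h}.
  move=> [[a c] [b d]] [[a' c'] [b' d']]; rewrite !in_fsetD !inE !fE /=.
  move=> /andP [_ /andP [_ /eqP e]] /andP [_ /andP [_ /eqP e']].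
  rewrite /h /= => -[cd cc aa]; move: cd e e'; rewrite -cc -aa => cd.
  rewrite -cd => <- /addrI /oppr_inj ->.
  by move: cd => /addrI /oppr_inj ->.
rewrite -(card_fimset hI); apply/fsubset_leq_card/fsubsetP => z.
case/imfsetP => -[[a c] [b d]] /=; rewrite !in_fsetD !inE !fE /=.
move=> /andP [nz /andP [/andP [/andP [aA cA] /andP [bA dA]] e]] ->.
by move: nz; rewrite aA cA bA dA e /= negbK => ->.
Qed.

(** The last hypothesis keeps the contribution of [Z] below half of [|A|^3]. *)
Lemma fractions_many A (Z : {fset R}) x m : A != fset0 ->
  #|` diffset A (lmul x A)|%:R <= m * #|` A|%:R ->
  2 * m * #|` Z|%:R <= #|` A|%:R ->
  #|` A|%:R ^+ 3 <= 2 * m * #|` fractions A Z x|%:R.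
Proof.
move=> A0 cxA cZ; have a0 : 0 < #|` A|%:R :> F by rewrite ltr0n cardfs_gt0.
have := card_fractions A Z x; rewrite -(ler_nat F) natrX natrM natrD natrM natrX.
move: a0 cxA cZ; set a := #|` A|%:R; set z := #|` Z|%:R;
  set d := #|` diffset _ _|%:R; set g := #|` fractions _ _ _|%:R.
move=> a0 cxA cZ le_a4.
have gz0 : 0 <= g + z * a ^+ 2 by rewrite addr_ge0 // mulr_ge0 // exprn_ge0 // ltW.
have {le_a4} : a ^+ 3 <= m * (g + z * a ^+ 2).
  rewrite -(ler_pM2l a0) -exprS (le_trans le_a4) // (mulrA a) [a * m]mulrC.
  exact: ler_wpM2r.
have : 2 * m * z * a ^+ 2 <= a * a ^+ 2 by rewrite ler_wpM2r // exprn_ge0 // ltW.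
lra.
Qed.

End Multiplication.

(* Stands for the condition |A + xA| <= m |A|, up to powers of the constants. *)
Definition tame (R : rngType) (F : realFieldType) (A : {fset R}) (m : F) (x : R) :=
  covers (diffset A A) m (lmul x (diffset A A)).

(** * The fractions form a finite subring *)

Section Fractions.

Variables (R : rngType) (F : realFieldType) (A : {fset R}) (k : F).
Local Notation D := (diffset A A).
Local Notation Z := (zero_divisors_in (subfs A A)).

Implicit Types (m : F) (x y u v : R).

Hypothesis A0 : A != fset0.
Hypothesis k1 : 1 <= k.
Hypothesis cardD : #|` D|%:R <= k * #|` A|%:R.
Hypothesis D2 : covers D k (sumset D D).

Local Lemma oppD : {in D, forall d, - d \in D}.
Proof. by move=> _ /diffsetP [a [b [aA bA ->]]]; rewrite opprB mem_diffset. Qed.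

Local Lemma k0 : 0 <= k.
Proof. exact: le_trans ler01 k1. Qed.

Local Lemma covers_self : covers D (1 : F) A.
Proof.
have [a aA] := fset0Pn _ A0; exists [fset a]; first by rewrite cardfs1.
apply/fsubsetP => b bA; rewrite -[b](subrKC a).
by rewrite mem_sumset ?fset11 // mem_diffset.
Qed.

Local Lemma covers_diff : covers D (1 : F) D.
Proof.
exists [fset 0]; first by rewrite cardfs1.
by apply/fsubsetP => b bD; rewrite -[b]add0r mem_sumset ?fset11.
Qed.

Lemma tame_of_covers m x : covers D m (lmul x A) -> tame A (m * m * k) x.
Proof.
by move=> cx; rewrite /tame -lmul_diffset; apply: covers_diffset oppD _ _ _.
Qed.

(** [(x - y) D] lies in [x D - y D]. *)
Lemma tameB m m' x y :
  tame A m x -> tame A m' y -> tame A (m * m' * k) (x - y).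
Proof.
move=> gx gy; apply: covers_fsubset (covers_diffset oppD D2 gx gy).
apply/fsubsetP => _ /imfsetP [d /= dD ->].
by rewrite rmulBl mem_diffset // in_imfset.
Qed.

(** Multiplication by [x] turns the translates of [D] covering [y D] into translates of [x D]. *)
Lemma tameM m m' x y :
  tame A m x -> tame A m' y -> tame A (m' * m) (x ** y).
Proof. by move=> gx gy; rewrite /tame -lmulA; apply: covers_lmul gx. Qed.

Lemma tame_covers m x : tame A m x -> covers D m (lmul x A).
Proof. by move=> gx; rewrite -[m]mul1r; apply: covers_lmul covers_self gx. Qed.

(* [D] is covered by translates of [u D], as [u A] is no smaller than [A], and
   [x] maps these to translates of [v D]. *)
Lemma tame_fraction m u v x : non_zero_divisor u -> x ** u = v ->
  tame A m u -> tame A m v -> tame A (m * m * k * k) x.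
Proof.
move=> nzu xu gu gv; have m0 := covers_ge0 gu.
have -> : m * m * k * k = m * k * k * m by ring.
apply: (@covers_lmul _ _ D (lmul u D)); last by rewrite lmulA xu.
(* Ruzsa covering with [B = u A] reduces this to [|D + u A| <= m k k |A|]. *)
rewrite -lmul_diffset; apply: covers_of_card.
  by rewrite -cardfs_gt0 card_lmul // cardfs_gt0.
rewrite card_lmul //.
apply: le_trans (covers_card (covers_sumset D2 covers_diff (tame_covers gu))) _.
by rewrite mul1r -[_ * k * #|` A|%:R]mulrA ler_wpM2l // mulr_ge0 // k0.
Qed.

Lemma tame_card m x : tame A m x ->
  #|` diffset A (lmul x A)|%:R <= m * k * k * #|` A|%:R.
Proof.
move=> gx; have m0 := covers_ge0 gx.
apply: le_trans (covers_card (covers_diffset oppD D2 covers_self (tame_covers gx))) _.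
by rewrite mul1r -[_ * k * #|` A|%:R]mulrA ler_wpM2l // mulr_ge0 // k0.
Qed.

Lemma notin_zero_divisors u : u \in D -> u \notin Z -> non_zero_divisor u.
Proof.
move=> uD uZ; apply/asboolP; apply: contraNT uZ => nzu.
by rewrite !inE /= uD.
Qed.

(** Elements of [D] are tame with constant [m1], fractions with [m2], and differences or products of
    two fractions with [m2 * m2 * k]; the last [k * k] in [M] comes from [tame_card]. Whatever is
    tame with [m2 * m2 * k] is again a fraction, hence tame with [m2], so no loss accumulates. *)
Lemma fractions_subring m :
  let m1 := m * m * k in let m2 := m1 * m1 * k * k in
  let M := m2 * m2 * k * k * k in
  1 <= m -> (forall a, a \in A -> tame A m a) ->
  2 * M * #|` Z|%:R <= #|` A|%:R ->
  exists S : {fset R},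
    [/\ is_subring S, A `<=` S & #|` S|%:R <= 2 * M * #|` A|%:R].
Proof.
move=> m1 m2 M m_ge1 gA cZ.
have a0 : 0 < #|` A|%:R :> F by rewrite ltr0n cardfs_gt0.
have m1_ge1 : 1 <= m1 by rewrite !mulr_ege1.
have m2_ge1 : 1 <= m2 by rewrite !mulr_ege1.
have grow (y z : F) : 1 <= y -> 1 <= z -> y <= y * z.
  by move=> y1 z1; rewrite ler_peMr // (le_trans ler01).
pose P := (A `*` A) `*` (A `*` A).
pose frac (q : (R * R) * (R * R)) x :=
  (q.1.1 - q.2.1 == x ** (q.1.2 - q.2.2)) && (q.1.2 - q.2.2 \notin Z).
have fracP q x : (q \in fractions A Z x) = (q \in P) && frac q x.
  by rewrite /P /frac !inE.
have nzP q : q \in P -> q.1.2 - q.2.2 \notin Z -> non_zero_divisor (q.1.2 - q.2.2).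
  rewrite !in_fsetM => /andP [/andP [_ cA] /andP [_ dA]].
  exact/notin_zero_divisors/mem_diffset.
pose rel q x := q \in P /\ frac q x.
(* Cancelling the non-zero-divisor [c - d] determines [x]. *)
have rel_inj q x y : rel q x -> rel q y -> x = y.
  move=> [qP /andP [/eqP ex nz]] [_ /andP [/eqP ey _]].
  by apply: (non_zero_divisor_injr (nzP _ qP nz)); rewrite -ex.
have [S SP] := fset_of_functional_rel P rel_inj.
have gS x : x \in S -> tame A m2 x.
  case/SP => q _ [qP /andP [/eqP ex nz]].
  have := qP; rewrite !in_fsetM => /andP [/andP [aA cA] /andP [bA dA]].
  by apply: tame_fraction (nzP _ qP nz) (esym ex) _ _; apply: tameB; exact: gA.
have many x : tame A (m2 * m2 * k) x ->
    #|` A|%:R ^+ 3 <= 2 * M * #|` fractions A Z x|%:R.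
  by move=> /tame_card cx; apply: fractions_many.
have Sg m' x : m' <= m2 * m2 * k -> tame A m' x -> x \in S.
  move=> le_m gx; have := many x (coversW le_m gx).
  have [->|/fset0Pn [q]] := eqVneq (fractions A Z x) fset0.
    by rewrite cardfs0 mulr0 leNgt exprn_gt0.
  by rewrite fracP => /andP [qP qx] _; apply/SP; exists q.
have AS : A `<=` S.
  apply/fsubsetP => a aA; apply: Sg (gA a aA).
  have e1 : m <= m1 by rewrite /m1 -(mulrA m) grow ?mulr_ege1.
  have e2 : m1 <= m2 by rewrite /m2 -(mulrA m1 m1 k) -(mulrA m1) grow ?mulr_ege1.
  by apply: le_trans (le_trans e1 e2) _; rewrite -(mulrA m2) grow ?mulr_ege1.
have SB : {in S &, forall x y, x - y \in S}.
  by move=> x y /gS gx /gS gy; apply: Sg (tameB gx gy).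
exists S; split=> //.
  split=> // [|x y /gS gx /gS gy].
    by have [a /(fsubsetP AS) aS] := fset0Pn _ A0; rewrite -(subrr a) SB.
  by apply: Sg (tameM gx gy); rewrite grow ?mulr_ege1.
have frac_inj x y q : (q \in P) && frac q x -> (q \in P) && frac q y -> x = y.
  by move=> /andP [? ?] /andP [? ?]; apply: (@rel_inj q).
(* Double counting: each of the [|A|^4] quadruples represents at most one [x], while each [x] in [S]
   has at least [|A|^3 / (2 M)] of them. *)
have : (\sum_(x <- S) #|` fractions A Z x| <= #|` A| ^ 4)%N.
  have -> : (#|` A| ^ 4)%N = #|` P| by rewrite !card_fsetM; ring.
  apply: leq_trans (sum_card_disjoint P S frac_inj).
  rewrite leq_eqVlt; apply/orP; left; apply/eqP; apply: eq_bigr => x _; congr #|` _|.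
  apply/fsetP => q; rewrite fracP in_fset [RHS]inE /=. by rewrite andbA andbb.
have cS : #|` S|%:R * #|` A|%:R ^+ 3 <=
    2 * M * (\sum_(x <- S) #|` fractions A Z x|)%:R :> F.
  rewrite card_fset_sum1 !natr_sum big_distrl /= mulr_sumr big_seq [leRHS]big_seq.
  by apply: ler_sum => x /gS gx; rewrite mul1r many //; apply: coversW gx;
    rewrite -(mulrA m2) grow ?mulr_ege1.
have M0 : 0 <= 2 * M by rewrite !mulr_ge0 ?k0 // (le_trans ler01).
rewrite -(ler_nat F) => /(ler_wpM2l M0) /(le_trans cS).
rewrite natrX [_ ^+ 4]exprS mulrA ler_pM2r // exprn_gt0 //.
Qed.

End Fractions.

(** * Choice of the constants and conclusion *)

Theorem theorem1p4 (F : realType) :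
  exists C : F, 0 < C /\
    forall (R : rngType) (A : {fset R}) (K : F),
      A != fset0 ->
      1 <= K ->
      #|` addfs A (mulfs A A)|%:R <= K * #|` A|%:R ->
      #|` A|%:R / K <= #|` mulfs A A|%:R ->
      C^-1 * (K `^ (- C)) * #|` A|%:R <= #|` zero_divisors_in (subfs A A)|%:R
      \/ exists S : {fset R},
           [/\ is_subring S, A `<=` S
             & #|` S|%:R <= C * (K `^ C) * #|` A|%:R].
Proof.
(* With [k = K^11] and [m = K^13], the exponents of [m1], [m2] and [M] are 37, 96 and 225. The same
   225 also absorbs the factor 2. *)
exists 225%:R; split=> // R A K A0 K1 cAP cP.
have K0 : 0 < K := lt_le_trans ltr01 K1.
rewrite powRN powR_mulrn ?(ltW K0) // -invfM.
have [many_zd|few_zd] := leP (_^-1 * _) (#|` zero_divisors_in _|%:R : F); [by left|right].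
set P := mulfs A A in cAP cP.
have a0 : 0 < #|` A|%:R :> F by rewrite ltr0n cardfs_gt0.
have P0 : P != fset0.
  have [a aA] := fset0Pn _ A0; apply/fset0Pn; exists (a ** a).
  by apply/imfset2P; exists a => //; exists a.
rewrite ler_pdivrMr // in cP.
(* Plunnecke is based at [P], the product set, so both hypotheses are spent here:
   [|P + A| <= K |A| <= K^2 |P|]. *)
have cPA : #|` sumset P A|%:R <= K ^+ 2 * #|` P|%:R :> F.
  rewrite sumsetC (le_trans cAP) // expr2 -mulrA ler_wpM2l ?(ltW K0) //.
  by rewrite mulrC.
(* The exponent is 5 times 2, plus 1 from [|P| <= |A + P| <= K |A|]. *)
have small : #|` diffset (sumset A (sumset A A)) (sumset A A)|%:R
    <= K ^+ 11 * #|` A|%:R :> F.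
  apply: le_trans (plunnecke P0 _ cPA) _; first by rewrite exprn_ge0 // ltW.
  rewrite -exprM /= exprSr -mulrA ler_wpM2l ?exprn_ge0 ?(ltW K0) //.
  by rewrite (le_trans _ cAP) // ler_nat /addfs -/(sumset A P) sumsetC leq_card_sumsetl.
have [a aA] := fset0Pn _ A0.
(* Here [(b - c) + a = (b + a + a) - (a + c)], so a translate of [A - A] lies in [3A - 2A]. *)
have cD : #|` diffset A A|%:R <= K ^+ 11 * #|` A|%:R :> F.
  apply: le_trans small; rewrite ler_nat -(card_sumset1 _ a).
  apply/fsubset_leq_card/fsubsetP.
  move=> z /sumsetP [_ [_ [/diffsetP [b [c [bA cA ->]]] /fset1P -> ->]]].
  by rewrite addrAC -(addrKA a) -(addrA b) mem_diffset ?mem_sumset.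
(* Ruzsa covering applies because [D + D + A] lies in [3A - 2A]. *)
have D2 : covers (diffset A A) (K ^+ 11) (sumset (diffset A A) (diffset A A)).
  apply: covers_of_card A0 (le_trans _ small); rewrite ler_nat.
  apply/fsubset_leq_card/fsubsetP => z.
  move=> /sumsetP [_ [b [/sumsetP [d [d' [dD d'D ->]]] bA ->]]].
  have /diffsetP [c [e [cA eA ->]]] := dD; have /diffsetP [c' [e' [c'A e'A ->]]] := d'D.
  by rewrite addrACA -opprD [_ + b]addrC addrA mem_diffset ?mem_sumset.
(* As [b A + A] lies in [A + P], the set [b A] is covered by [K] translates of [D]. *)
have tameA b : b \in A -> tame A (K ^+ 13) b.
  move=> bA; have -> : K ^+ 13 = K * K * K ^+ 11 by ring.
  apply: tame_of_covers D2 _ _ _; apply: covers_of_card A0 (le_trans _ cAP).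
  rewrite ler_nat; apply/fsubset_leq_card; rewrite sumsetC; apply: sumsetS => //.
  apply/fsubsetP => _ /imfsetP [c /= cA ->].
  by apply/imfset2P; exists b => //; exists c.
have k1 n : 1 <= K ^+ n by rewrite exprn_ege1.
have := fractions_subring A0 (k1 11%N) cD D2 (k1 13%N) tameA.
have powK (k m : F) : k = K ^+ 11 -> m = K ^+ 13 ->
  m * m * k * (m * m * k) * k * k * (m * m * k * (m * m * k) * k * k) * k * k * k
  = K ^+ 225 by move=> -> ->; rewrite -!exprD.
rewrite (powK _ _ erefl erefl).
have C2 : 2 * K ^+ 225 <= 225%:R * K ^+ 225.
  by rewrite ler_wpM2r ?exprn_ge0 ?(ltW K0) // ler_nat.
case=> // [|S [ringS AS cS]].
  have c0 : 0 < 225%:R * K ^+ 225 by rewrite mulr_gt0 ?exprn_gt0.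
  move: (ltW few_zd); rewrite ler_pdivlMl // => /(le_trans _); apply.
  by rewrite ler_wpM2r.
by exists S; split=> //; rewrite (le_trans cS) // ler_wpM2r.
Qed.
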